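(* If $G$ is a connected graph on an odd number $n\geq 3$ of vertices with $q(G)=2$ and $|E(G)|=2n-3$, then $G$ is isomorphic to the single-ended candle $G'_{(n-1)/2}$.
   Context: For a graph $G$ on $n$ vertices, $\mathcal{S}(G)$ is the set of real symmetric $n\times n$ matrices $A=[a_{ij}]$ with $a_{ij}\neq0$ for $i\ne j$ iff $\{i,j\}\in E(G)$ (diagonal unrestricted); $q(G)$ is the minimum number of distinct eigenvalues of a matrix in $\mathcal{S}(G)$. Single-ended candle: for $k\ge1$, $G'_k$ is the graph on $\{1,\dots,2k+1\}$ with levels $L_0=\{1\}$, $L_i=\{2i,2i+1\}$ ($1\le i\le k$), in which any two vertices in consecutive levels are adjacent, $2k$ and $2k+1$ are adjacent, and there are no other edges ($G'_1=K_3$). *)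

(* Defs.v *)
From HB Require Import structures.
From mathcomp Require Import all_boot all_order all_algebra.
From mathcomp Require Import Rstruct.
Set Implicit Arguments. Unset Strict Implicit. Unset Printing Implicit Defensive.
Import Order.TTheory GRing.Theory Num.Theory.
Local Open Scope ring_scope.

Definition simple_graph (n : nat) (e : rel 'I_n) : Prop :=
  symmetric e /\ irreflexive e.

Definition graph_connected (n : nat) (e : rel 'I_n) : Prop :=
  forall i j : 'I_n, connect e i j.

Definition num_edges (n : nat) (e : rel 'I_n) : nat :=
  #|[set p : 'I_n * 'I_n | (p.1 < p.2)%N && e p.1 p.2]|.

Definition in_SG (n : nat) (e : rel 'I_n) (A : 'M[Rdefinitions.R]_n) : Prop :=
  A^T = A /\ forall i j : 'I_n, i != j -> (A i j != 0) = e i j.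

Definition num_distinct_eig (n : nat) (A : 'M[Rdefinitions.R]_n) (k : nat) : Prop :=
  exists s : seq Rdefinitions.R, [/\ uniq s, size s = k & forall a : Rdefinitions.R, eigenvalue A a <-> a \in s].

Definition q_eq (n : nat) (e : rel 'I_n) (k : nat) : Prop :=
  (exists A, in_SG e A /\ num_distinct_eig A k) /\
  (forall A m, in_SG e A -> num_distinct_eig A m -> (k <= m)%N).

(* Single-ended candle G'_k on vertices 0..2k (0-based; vertex v is vertex
   v+1 of the paper).  Level of 0-based vertex v is (v+1)/2. *)
Definition candle_rel (k : nat) (u v : nat) : bool :=
  let lu := (u.+1)./2 in let lv := (v.+1)./2 in
  (u != v) && [|| lu.+1 == lv, lv.+1 == lu | (lu == k) && (lv == k)].

(* Main.v *)
Require Import Defs.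
From HB Require Import structures.
From mathcomp Require Import all_boot all_order all_algebra all_fingroup.
From mathcomp Require Import complex Rstruct.
From mathcomp Require Import zify ring.
Set Implicit Arguments. Unset Strict Implicit. Unset Printing Implicit Defensive.
Import Order.TTheory GRing.Theory Num.Theory.

(** A matrix of [S(G)] with two eigenvalues becomes, after a diagonal shift, a symmetric matrix
    with pairwise orthogonal rows.  Hence two nonadjacent vertices with a common neighbour have
    a second one, and [G] is not bipartite because [n] is odd.

    In the breadth-first levels from a vertex [v], every vertex at distance at least 2 therefore
    has at least two neighbours in the previous level.  Counting the [2n - 3] edges, the number
    of edges inside levels plus the number of surplus backward edges equals [deg v - 1]; the
    first number is positive since [G] is not bipartite.  As the average degree is below 4,
    some vertex has degree 2 or 3.

    If [deg v = 2], exactly one edge lies inside a level and all other edges are forced: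
    vertices of a level have the same two backward neighbours, so their rows restricted to these
    are parallel and need a further common neighbour.  This bounds every level by 2, and the
    parity of [n] forces every level after the first to have 2 vertices, so [G] is a candle.

    If all degrees are at least 3 and [deg v = 3], there are either one inner edge and one
    surplus backward edge, or two inner edges.  A vertex [w] with exactly two backward neighbours
    forces these to have equal backward neighbourhoods; this excludes all configurations except
    two whose levels end at distance at most 3, with 6 or 8 vertices, against the parity of [n]. *)

(** * Matrices with two eigenvalues *)

Section TwoEigenvalues.
Local Open Scope ring_scope.

(** Over the complex numbers [A] is unitarily diagonalisable, with real diagonal entries that are
    eigenvalues of [A] itself. Each is [r] or [s], so the product vanishes on the diagonal form. *)
Lemma symmetric_two_eigenvalues_annihilated (R : rcfType) n (A : 'M[R]_n) (r s : R) :
  A^T = A -> (forall a, eigenvalue A a -> a \in [:: r; s]) ->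
  (A - r%:M) *m (A - s%:M) = 0.
Proof.
move=> symA eigA; pose f := real_complex R; pose Ac := map_mx f A.
have hermA : Ac \is hermsymmx.
  apply: realsym_hermsym.
    by apply/is_hermitianmxP; rewrite expr0 scale1r map_mx_id // /Ac map_trmx symA.
  by apply/mxOverP => i j; rewrite mxE complex_real.
have normA := hermitian_normalmx hermA.
have /orthomx_spectralP AE := normA.
have /mxOverP realD := hermitian_spectral_diag_real hermA.
set P := spectralmx Ac in AE; set D := spectral_diag Ac in AE realD.
have Pu : P \in unitmx by apply: spectral_unit.
have PA : P *m Ac = diag_mx D *m P by rewrite {1}AE !mulmxA mulmxV // mul1mx.
have DE i : D 0 i \in [:: f r; f s].
  have /complex_realP[x Dx] := realD 0 i.
  have : eigenvalue Ac (f x).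
    apply/eigenvalueP; exists (row i P).
      by rewrite -row_mul PA row_mul row_diag_mx -scalemxAl -rowE Dx.
    apply: contraTneq Pu => Pi0; rewrite -row_free_unit.
    apply/negP => /row_free_inj inj.
    have /inj/rowP/(_ i)/eqP : ('e_i : 'rV_n) *m P = 0 *m P by rewrite mul0mx -rowE.
    by rewrite !mxE !eqxx oner_eq0.
  rewrite eigenvalue_map => /eigA; rewrite Dx !inE.
  by case/orP=> /eqP->; rewrite eqxx ?orbT.
have AP a : P *m (Ac - (f a)%:M) = (diag_mx D - (f a)%:M) *m P.
  by rewrite mulmxBr mulmxBl PA scalar_mxC.
apply: (map_mx_inj (f := f)).
rewrite map_mxM !map_mxB !map_scalar_mx map_mx0 -/Ac.
apply: (can_inj (mulKmx Pu)); rewrite mulmxA AP -mulmxA AP mulmxA mulmx0.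
suff -> : (diag_mx D - (f r)%:M) *m (diag_mx D - (f s)%:M) = 0 by rewrite mul0mx.
rewrite -!diag_const_mx -!raddfB mulmx_diag; apply/matrixP=> i j; rewrite !mxE.
by have := DE i; rewrite !inE => /orP[]/eqP->; rewrite subrr ?mul0r ?mulr0 mul0rn.
Qed.

Lemma two_eigenvalues_orthogonal_rows (R : rcfType) n (A : 'M[R]_n) (r s : R) :
  A^T = A -> (forall a, eigenvalue A a -> a \in [:: r; s]) ->
  exists B : 'M[R]_n, [/\ B^T = B, forall i j, i != j -> B i j = A i j &
    forall i j, i != j -> (\sum_k B i k * B j k = 0)%R].
Proof.
(* Shifting by the midpoint of [r] and [s] gives a matrix whose square is the scalar
   [((r - s) / 2) ^ 2], written [t ^ 2 - r * s] below. *)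
move=> symA eigA; pose t := ((r + s) / 2%:R)%R; pose B := (A - t%:M)%R.
have BT : (B^T = B)%R by rewrite /B raddfB /= tr_scalar_mx symA.
exists B; split=> // [i j nij|i j nij]; first by rewrite !mxE (negPf nij) mulr0n subr0.
have BB : (B *m B = (t ^+ 2 - r * s)%:M)%R.
  have AA := symmetric_two_eigenvalues_annihilated symA eigA.
  rewrite mulmxBl !mulmxBr -scalar_mxM mul_scalar_mx mul_mx_scalar in AA.
  rewrite [in LHS]/B mulmxBl !mulmxBr -scalar_mxM mul_scalar_mx mul_mx_scalar.
  apply/matrixP => k l; move/matrixP/(_ k l): AA; rewrite !mxE => /eqP.
  rewrite subr_eq0 subr_eq => /eqP->; rewrite /t.
  by case: (k == l); rewrite ?mulr1n ?mulr0n; field.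
have : ((B *m B) i j = 0)%R by rewrite BB mxE (negPf nij) mulr0n.
rewrite mxE => BBij; rewrite -[RHS]BBij; apply: eq_bigr => k _.
by rewrite -[in LHS]BT [(B^T)%R j k]mxE BT.
Qed.

End TwoEigenvalues.

(** * Graphs of symmetric matrices with orthogonal rows *)

Section OrthogonalRows.
Local Open Scope ring_scope.
Variables (R : realFieldType) (n : nat) (e : rel 'I_n) (B : 'M[R]_n).
Hypothesis e_irr : irreflexive e.
Hypothesis B_sym : B^T = B.
Hypothesis B_pattern : forall i j, i != j -> (B i j != 0) = e i j.
Hypothesis B_orth : forall i j, i != j -> \sum_k B i k * B j k = 0.

Let entry_neq0 x y : e x y -> B x y != 0.
Proof.
move=> exy; rewrite B_pattern //.
by apply: contraTneq exy => ->; rewrite e_irr.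
Qed.

Let entry_eq0 x y : x != y -> ~~ e x y -> B x y = 0.
Proof. by move=> nxy nexy; apply/eqP; apply: contraNT nexy; rewrite B_pattern. Qed.

Let e_sym : symmetric e.
Proof.
move=> x y; have [->//|nxy] := eqVneq x y.
have nyx : y != x by rewrite eq_sym.
by rewrite -(B_pattern nxy) -(B_pattern nyx) -[in LHS]B_sym mxE.
Qed.

Let entry_eq0C x y : x != y -> ~~ e x y -> B y x = 0.
Proof. by rewrite eq_sym e_sym; apply: entry_eq0. Qed.

(** The diagonal of [B] is arbitrary, but in this scalar product its entries are multiplied by
    [B x y = 0]. *)
Let term_neq0 x y w : x != y -> ~~ e x y ->
  B x w * B y w != 0 -> e x w && e y w.
Proof.
move=> nxy nexy; rewrite mulf_eq0 negb_or => /andP[].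
have [<-|nxw] := eqVneq x w.
  by rewrite (entry_eq0C nxy) ?eqxx ?andbF.
have [<-|nyw] := eqVneq y w; first by rewrite entry_eq0 ?eqxx.
by rewrite !B_pattern // => -> ->.
Qed.

(** Only common neighbours contribute to the scalar product of the two rows, and a single nonzero
    term cannot sum to 0. *)
Lemma orthogonal_second_common_neighbour x y w :
  x != y -> ~~ e x y -> e x w -> e y w -> exists w', [/\ w' != w, e x w' & e y w'].
Proof.
move=> nxy nexy exw eyw.
case: (pickP [pred w' | [&& w' != w, e x w' & e y w']]) => [w' /and3P[]|noW].
  by exists w'.
have /eqP := B_orth nxy; rewrite (bigD1 w) //= big1 ?addr0 => [|k nkw].
  by rewrite mulf_eq0 !(negPf (entry_neq0 _)).
apply/eqP; apply/negP => /negP /(term_neq0 nxy nexy) /andP[exk eyk].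
by have := noW k; rewrite /= nkw exk eyk.
Qed.

(** On the coordinates [w1], [w2] the rows of [x] and [x'] are both orthogonal to that of [z], hence
    parallel. Their scalar product there is nonzero and must be cancelled by another common
    neighbour. *)
Lemma orthogonal_parallel_rows z x x' w1 w2 :
  z != x -> z != x' -> x != x' -> ~~ e z x -> ~~ e z x' -> ~~ e x x' ->
  w1 != w2 ->
  (forall w, e z w -> e x w = (w \in [:: w1; w2])) ->
  (forall w, e z w -> e x' w = (w \in [:: w1; w2])) ->
  e z w1 -> e z w2 ->
  exists w, [/\ w \notin [:: w1; w2], e x w & e x' w].
Proof.
move=> nzx nzx' nxx' nezx nezx' nexx' nw12 zx zx' ezw1 ezw2.
have two p q : p != q -> ~~ e p q ->
    (forall w, e p w -> e q w -> w \in [:: w1; w2]) ->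
    B p w1 * B q w1 + B p w2 * B q w2 = 0.
  move=> npq nepq pq; rewrite -(B_orth npq) (bigD1 w1) //= (bigD1 w2) 1?eq_sym //=.
  rewrite big1 ?addr0 // => k /andP[nk1 nk2].
  apply/eqP; apply/negP => /negP /(term_neq0 npq nepq) /andP[epk eqk].
  by have := pq k epk eqk; rewrite !inE (negPf nk1) (negPf nk2).
have E1 := two _ _ nzx nezx (fun w zw => etrans (esym (zx w zw))).
have E2 := two _ _ nzx' nezx' (fun w zw => etrans (esym (zx' w zw))).
case: (pickP [pred w | [&& w \notin [:: w1; w2], e x w & e x' w]]) => [w /and3P[]|noW].
  by exists w.
have E3 := two _ _ nxx' nexx' _.
have {}E3 : B x w1 * B x' w1 + B x w2 * B x' w2 = 0.
  apply: E3 => w exw ex'w; have := noW w.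
  by rewrite /= exw ex'w !andbT => /negbFE.
have /eqP : (B z w1 ^+ 2 + B z w2 ^+ 2) * (B x w1 * B x' w1) = 0.
  transitivity (B z w2 ^+ 2 * (B x w1 * B x' w1 + B x w2 * B x' w2)
     - (B z w1 * B x w1 + B z w2 * B x w2) * (B z w2 * B x' w2)
     + B z w1 * B x w1 * (B z w1 * B x' w1 + B z w2 * B x' w2)); first by ring.
  by rewrite E1 E2 E3 !(mulr0, mul0r) subrr addr0.
rewrite !mulf_eq0 paddr_eq0 ?sqr_ge0 // !expf_eq0 /= !(negPf (entry_neq0 _)) //.
  by rewrite zx' // mem_head.
by rewrite zx // mem_head.
Qed.

(* If [M] is the off-diagonal part of [B] and [S] the sign matrix of a proper 2-colouring,
   then [M] is invertible because its rows are orthogonal, while [S M S = - M]. *)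
Lemma orthogonal_not_bipartite (c : 'I_n -> bool) :
  odd n -> (forall x, exists y, e x y) -> ~ (forall x y, e x y -> c x != c y).
Proof.
move=> oddn nbr col.
pose M := \matrix_(i, j) (if i == j then 0 else B i j) : 'M[R]_n.
pose S := diag_mx (\row_i (-1) ^+ c i) : 'M[R]_n.
have Mneq0 i j : M i j != 0 -> c i != c j.
  rewrite mxE; case: (eqVneq i j) => [_|nij]; first by rewrite eqxx.
  by rewrite B_pattern // => /col.
have SMS : S *m M *m S = - M.
  apply/matrixP=> i j; rewrite mul_mx_diag mul_diag_mx !mxE.
  have := Mneq0 i j; rewrite mxE; case: (eqVneq i j) => [_ _|nij].
    by rewrite mulr0 mul0r oppr0.
  have [->|_ /(_ isT)] := eqVneq (B i j) 0; first by rewrite mulr0 mul0r oppr0.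
  by case: (c i); case: (c j) => //= _; rewrite ?expr1 ?expr0; ring.
have SS : S *m S = 1%:M.
  rewrite mulmx_diag; apply/matrixP=> i j; rewrite !mxE.
  by rewrite -signr_addb addbb.
have M2 : M *m M^T = diag_mx (\row_i \sum_k M i k ^+ 2).
  apply/matrixP => i j; rewrite !mxE.
  have [<-|nij] := eqVneq i j; first by apply: eq_bigr => k _; rewrite [M^T _ _]mxE expr2.
  (* Vertices of one colour are nonadjacent, so clearing the diagonal does not alter their scalar
     product; vertices of different colours have no common neighbour. *)
  rewrite mulr0n; have [cij|ncij] := eqVneq (c i) (c j).
    have neij : ~~ e i j by apply/negP => /col; rewrite cij eqxx.
    rewrite -[RHS](B_orth nij); apply: eq_bigr => k _; rewrite !mxE.
    case: (eqVneq i k) => [<-|_]; last case: (eqVneq j k) => [<-|//].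
      by rewrite (entry_eq0C nij) // ?mul0r ?mulr0.
    by rewrite (entry_eq0 nij) // ?mul0r ?mulr0.
  rewrite big1 // => k _; rewrite [M^T _ _]mxE; apply/eqP; apply: contraNT ncij.
  rewrite mulf_eq0 negb_or => /andP[/Mneq0 + /Mneq0].
  by case: (c i); case: (c j); case: (c k).
have detM : \det M != 0.
  have : \det (M *m M^T) != 0.
    rewrite M2 det_diag; apply/prodf_neq0 => i _; rewrite mxE.
    have [j eij] := nbr i; rewrite (bigD1 j) //= gt_eqF // ltr_pwDl //.
      by rewrite exprn_even_gt0 //= mxE; case: (eqVneq i j) => [ij|_]; rewrite ?entry_neq0 //;
         move: eij; rewrite ij e_irr.
    by apply: sumr_ge0 => k _; apply: sqr_ge0.
  by rewrite det_mulmx mulf_eq0 negb_or => /andP[].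
(* As [S] squares to 1 and [n] is odd, this gives [\det M = - \det M]. *)
have := congr1 determinant SMS; rewrite !det_mulmx mulrAC -det_mulmx SS det1 mul1r.
rewrite -scaleN1r detZ -signr_odd oddn expr1 mulN1r => /eqP.
by rewrite eq_sym eqNr (negPf detM).
Qed.

End OrthogonalRows.

(** * Breadth-first levels *)

Section GraphCounting.
Variables (T : finType) (e : rel T).
Hypothesis e_sym : symmetric e.

Lemma card_rel_pairs (P : rel T) :
  #|[set p : T * T | P p.1 p.2]| = \sum_x \sum_y (P x y : nat).
Proof.
rewrite pair_bigA /= -sum1_card big_mkcond /=.
by apply: eq_bigr => p _; rewrite inE; case: (P _ _).
Qed.

Lemma card_sum_nbr (P : pred T) : #|[set y | P y]| = \sum_y (P y : nat).
Proof. by rewrite -sum1_card big_mkcond; apply: eq_bigr => y _; rewrite inE; case: (P y). Qed.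

(** [d x] is the least length of a walk from [v] to [x]; the three properties are all that later
    arguments use of it. *)
Lemma exists_distance (v : T) : (forall x, connect e v x) ->
  exists d : T -> nat,
  [/\ forall x, (d x == 0) = (x == v),
      forall x y, e x y -> d y <= (d x).+1 &
      forall x, 0 < d x -> exists2 y, e x y & d x = (d y).+1].
Proof.
move=> conn.
pose walk k x := [exists p : k.-tuple T, path e v p && (last v p == x)].
have walkP k x : reflect (exists p : seq T, [/\ size p = k, path e v p & last v p = x]) (walk k x).
  apply: (iffP existsP) => [[p /andP[pp /eqP lp]]|[p [<- pp lp]]].
    by exists p; rewrite size_tuple.
  by exists (in_tuple p); rewrite pp lp eqxx.
have exw x : exists k, walk k x.
  have /connectP[p pp ->] := conn x.
  by exists (size p); apply/walkP; exists p.
exists (fun x => ex_minn (exw x)); split=> [x|x y exy|x].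
- case: ex_minnP => m /walkP[p [<- pp <-]] minp.
  apply/eqP/eqP => [/size0nil->//|pv].
  by apply/eqP; rewrite -leqn0 minp //; apply/walkP; exists [::].
- case: (ex_minnP (exw y)) => m _ minm.
  case: (ex_minnP (exw x)) => k /walkP[p [<- pp px]] _.
  apply: minm; apply/walkP; exists (rcons p y).
  by rewrite size_rcons last_rcons rcons_path pp px.
case: ex_minnP => m /walkP[p [<- + px]] minm.
case/lastP: p px minm => // p z; rewrite last_rcons => -> minm.
rewrite rcons_path => /andP[pp ez] _.
exists (last v p); first by rewrite e_sym.
rewrite size_rcons; congr _.+1.
case: ex_minnP => k /walkP[q [<- qq ql]] mink.
apply/eqP; rewrite eqn_leq mink; last by apply/walkP; exists p.
rewrite andbT -ltnS -(size_rcons p x) -(size_rcons q x) minm //.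
by apply/walkP; exists (rcons q x); rewrite last_rcons rcons_path qq ql.
Qed.

End GraphCounting.

Lemma card_edge_pairs n (e : rel 'I_n) : symmetric e -> irreflexive e ->
  #|[set p | e p.1 p.2]| = 2 * num_edges e.
Proof.
move=> e_sym e_irr; rewrite /num_edges !card_rel_pairs.
pose up (x y : 'I_n) := (x < y) && e x y.
transitivity (\sum_x \sum_y (up x y : nat) + \sum_x \sum_y (up y x : nat)).
  rewrite -big_split; apply: eq_bigr => x _; rewrite -big_split; apply: eq_bigr => y _ /=.
  rewrite /up (e_sym y x); case: ltngtP => [_|_|/val_inj->]; rewrite ?addn0 //.
  by rewrite e_irr.
rewrite [X in _ + X]exchange_big /= mul2n -addnn.
by congr (_ + _); rewrite -card_rel_pairs.
Qed.

(** * Backward neighbours and edges inside levels *)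

Section Levels.
Variables (T : finType) (e : rel T).
Hypothesis e_sym : symmetric e.
Hypothesis e_irr : irreflexive e.
Hypothesis second_common : forall x y w, x != y -> ~~ e x y -> e x w -> e y w ->
  exists w', [/\ w' != w, e x w' & e y w'].
Variables (v : T) (d : T -> nat).
Hypothesis d_eq0 : forall x, (d x == 0) = (x == v).
Hypothesis d_lip : forall x y, e x y -> d y <= (d x).+1.
Hypothesis d_pred : forall x, 0 < d x -> exists2 y, e x y & d x = (d y).+1.

Definition back x := [set y | e x y && (d x == (d y).+1)].
Definition level k := [set x | d x == k].
(* Ordered pairs: every edge inside a level is counted twice. *)
Definition inlevel := [set p : T * T | e p.1 p.2 && (d p.1 == d p.2)].

Lemma in_back x y : (y \in back x) = e x y && (d x == (d y).+1).
Proof. by rewrite inE. Qed.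

Lemma in_level k x : (x \in level k) = (d x == k).
Proof. by rewrite inE. Qed.

Lemma in_inlevel x y : ((x, y) \in inlevel) = e x y && (d x == d y).
Proof. by rewrite inE. Qed.

Lemma edge_levels x y : e x y -> [\/ d x = d y, d x = (d y).+1 | d y = (d x).+1].
Proof.
move=> exy; have := d_lip exy; rewrite e_sym in exy; have := d_lip exy => ? ?.
have [?|[?|?]] : d x = d y \/ d x = (d y).+1 \/ d y = (d x).+1 by lia.
- by constructor 1.
- by constructor 2.
- by constructor 3.
Qed.

Lemma d_v : d v = 0.
Proof. by apply/eqP; rewrite d_eq0. Qed.

Lemma edge_neq x y : e x y -> x != y.
Proof. by apply: contraTneq => ->; rewrite e_irr. Qed.

Lemma level_nonadjacent x w : d w = (d x).+2 -> ~~ e x w.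
Proof. by move=> dw; apply/negP => /edge_levels[]; lia. Qed.

Lemma common_two_levels x w u : d w = (d x).+2 -> e x u -> e u w -> d u = (d x).+1.
Proof. by move=> dw /edge_levels + /edge_levels; move=> [? [] ?|? [] ?|? [] ?]; lia. Qed.

(** Vertices two levels apart are nonadjacent, so [u] is not their only common neighbour, and every
    common neighbour lies on the level between. *)
Lemma second_path_two_levels x w u : d w = (d x).+2 -> e x u -> e u w ->
  exists u', [/\ u' != u, e x u', u' \in back w & x \in back u'].
Proof.
move=> dw exu euw; have nexw := level_nonadjacent dw.
have nxw : x != w by apply/eqP => xw; move: dw; rewrite xw; lia.
rewrite e_sym in euw.
have [u' [nu exu' ewu']] := second_common nxw nexw exu euw.
have du' : d u' = (d x).+1 by apply: common_two_levels dw _ _; rewrite // e_sym.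
by exists u'; rewrite !in_back ewu' dw du' (e_sym u') exu' !eqxx.
Qed.

(** A shortest path back from [x] runs through [u] to some [w] two levels lower; the second path
    between [x] and [w] yields another backward neighbour. *)
Lemma card_back_ge2 x : 2 <= d x -> 2 <= #|back x|.
Proof.
move=> dx; have [u exu du] := d_pred (ltnW dx).
have [|w euw dw] := d_pred (x := u); first by lia.
rewrite e_sym in exu.
have dxw : d x = (d w).+2 by lia.
rewrite e_sym in euw.
have [u' [nu ewu' u'x _]] := second_path_two_levels dxw euw exu.
have ux : u \in back x by rewrite in_back e_sym exu du eqxx.
by rewrite (cardsD1 u) ux (cardsD1 u') !inE nu -in_back u'x.
Qed.

Lemma back_level1 x : d x = 1 -> back x = [set v].
Proof.
move=> dx; apply/setP => y; rewrite in_back inE dx eqSS eq_sym d_eq0.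
apply/andP/eqP => [[_ /eqP->]//|->]; split=> //.
have [|y' exy'] := d_pred (x := x); first by rewrite dx.
by rewrite dx => -[] /esym/eqP; rewrite d_eq0 => /eqP <-.
Qed.

Lemma back_v : back v = set0.
Proof. by apply/setP => y; rewrite in_back d_v inE andbF. Qed.

Lemma nbr_v x : e v x = (d x == 1).
Proof.
apply/idP/eqP => [evx|dx]; last first.
  have : v \in back x by rewrite back_level1 // inE.
  by rewrite in_back e_sym => /andP[].
have := d_lip evx; rewrite d_v leq_eqVlt ltnS leqn0 d_eq0 => /orP[/eqP//|/eqP xv].
by move: evx; rewrite xv e_irr.
Qed.

(** A path from [a] in [back x] through [x] to [w] has a companion avoiding [x], which can only pass
    through [x']; so [a] is in [back x'], and symmetrically. *)
Lemma back2_eq w x x' : 2 <= d w -> back w = [set x; x'] -> back x = back x'.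
Proof.
move=> dw bw.
have half y y' : back w = [set y; y'] -> back y \subset back y'.
  move=> bw'; apply/subsetP => a; rewrite in_back => /andP[eya /eqP dy].
  have : y \in back w by rewrite bw' !inE eqxx.
  rewrite in_back => /andP[ewy /eqP dwy].
  have dwa : d w = (d a).+2 by lia.
  rewrite e_sym in eya; rewrite e_sym in ewy.
  have [u [nu _ + bu]] := second_path_two_levels dwa eya ewy.
  by rewrite bw' in_set2 (negPf nu) /= => /eqP <-.
by apply/eqP; rewrite eqEsubset (half _ _ bw) half // bw setUC.
Qed.

Lemma card_edges_levels :
  #|[set p | e p.1 p.2]| = #|inlevel| + 2 * \sum_x #|back x|.
Proof.
pose bk x y := e x y && (d x == (d y).+1).
pose il x y := e x y && (d x == d y).
rewrite card_rel_pairs (card_rel_pairs il).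
have -> : \sum_x #|back x| = \sum_x \sum_y (bk x y : nat).
  by apply: eq_bigr => x _; rewrite card_sum_nbr.
rewrite mul2n -addnn [in X in _ + (_ + X)]exchange_big /= -!big_split.
apply: eq_bigr => x _; rewrite -!big_split; apply: eq_bigr => y _ /=.
rewrite /bk /il (e_sym y x); case exy: (e x y) => //=.
by case: (edge_levels exy) => ->; lia.
Qed.

Lemma card_level_sum K : (forall x, d x < K) -> #|T| = \sum_(k < K) #|level k|.
Proof.
move=> dK; rewrite -sum1_card (partition_big (fun x => Ordinal (dK x)) xpredT) //=.
apply: eq_bigr => k _; rewrite sum1dep_card; apply: eq_card => x.
by rewrite !inE -val_eqE.
Qed.

Lemma level_below k x : k <= d x -> exists y, d y = k.
Proof.
move=> kx; have [m] := ubnP (d x); elim: m x kx => // m IH x kx xm.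
have [<-|nk] := eqVneq (d x) k; first by exists x.
have [|y _ dy] := d_pred (x := x); first by lia.
by apply: (IH y); lia.
Qed.

(** [back x] has no element at the root, one on level 1 and at least two further out. So the
    truncated subtraction is exact, and the sum counts the surplus backward edges. *)
Lemma excess :
  #|[set p | e p.1 p.2]| + 2 * #|level 1| + 4 =
  #|inlevel| + 4 * #|T| + 2 * \sum_(x | 2 <= d x) (#|back x| - 2).
Proof.
rewrite card_edges_levels.
have : \sum_x (#|back x| + ((d x == 0) + (d x == 0) + (d x == 1))) =
       \sum_x (2 + (if 2 <= d x then #|back x| - 2 else 0)).
  apply: eq_bigr => x _; case: (ltngtP (d x) 1) (@card_back_ge2 x) => [dx _|dx|dx _].
  - have dx0 : d x == 0 by lia.
    by rewrite dx0; move: dx0; rewrite d_eq0 => /eqP->; rewrite back_v cards0.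
  - by have -> : (d x == 0) = false; lia.
  - by rewrite dx back_level1 // cards1.
have -> : \sum_(x | 2 <= d x) (#|back x| - 2) =
          \sum_x (if 2 <= d x then #|back x| - 2 else 0).
  by rewrite [LHS]big_mkcond.
have sum2 : \sum_(x : T) 2 = #|T| * 2 by rewrite sum_nat_const.
rewrite !big_split /=.
rewrite -!card_sum_nbr -/(level 1) (_ : [set y | d y == 0] = [set v]); last first.
  by apply/setP => x; rewrite !inE d_eq0.
by rewrite cards1 sum2; move: #|T| #|level 1| #|inlevel| => cT c1 ci; lia.
Qed.

Lemma inlevelC x y : ((x, y) \in inlevel) = ((y, x) \in inlevel).
Proof. by rewrite !in_inlevel e_sym eq_sym. Qed.

Lemma inlevel_diag x : (x, x) \in inlevel = false.
Proof. by rewrite in_inlevel e_irr. Qed.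

Lemma inlevel_neq x y : (x, y) \in inlevel -> x != y.
Proof. by apply: contraTneq => ->; rewrite inlevel_diag. Qed.

Lemma inlevel_two p q x y : #|inlevel| = 2 ->
  (p, q) \in inlevel -> (x, y) \in inlevel -> (x, y) = (p, q) \/ (x, y) = (q, p).
Proof.
move=> c2 pq xy.
have : [set (p, q); (q, p)] == inlevel.
  rewrite eqEcard c2 cards2 xpair_eqE (negPf (inlevel_neq pq)) andbT.
  by apply/subsetP => z; rewrite in_set2 => /orP[]/eqP-> //; rewrite inlevelC.
by move/eqP=> S; move: xy; rewrite -S in_set2 => /orP[]/eqP->; [left|right].
Qed.

Lemma inlevel_four p q p' q' x y : #|inlevel| = 4 ->
  (p, q) \in inlevel -> (p', q') \in inlevel -> (p', q') != (p, q) -> (p', q') != (q, p) ->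
  (x, y) \in inlevel ->
  [\/ (x, y) = (p, q), (x, y) = (q, p), (x, y) = (p', q') | (x, y) = (q', p')].
Proof.
move=> c4 pq pq' n1 n2 xy; pose S := [:: (p, q); (q, p); (p', q'); (q', p')].
have uS : uniq S.
  have nq := inlevel_neq pq; have nq' := inlevel_neq pq'.
  rewrite /= !inE !negb_or !xpair_eqE (eq_sym q p) (negPf nq) (negPf nq') (eq_sym q' p').
  rewrite !xpair_eqE in n1 n2; rewrite !(eq_sym p) !(eq_sym q) (negPf nq') n1 n2.
  by rewrite (andbC (q' == p)) n2 (andbC (q' == q)) n1.
have /(uniq_min_size uS) : {subset S <= enum inlevel}.
  move=> z; rewrite mem_enum /S !in_cons orbF.
  by move=> /or4P[]/eqP->; rewrite // inlevelC.
rewrite -cardE c4 => /(_ isT)[_ /(_ (x, y))].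
rewrite mem_enum xy /S !in_cons orbF => /or4P[]/eqP->; by [constructor 1|constructor 2|constructor 3|constructor 4].
Qed.

Hypothesis parallel : forall z x x' w1 w2,
  z != x -> z != x' -> x != x' -> ~~ e z x -> ~~ e z x' -> ~~ e x x' -> w1 != w2 ->
  (forall w, e z w -> e x w = (w \in [:: w1; w2])) ->
  (forall w, e z w -> e x' w = (w \in [:: w1; w2])) ->
  e z w1 -> e z w2 ->
  exists w, [/\ w \notin [:: w1; w2], e x w & e x' w].

Lemma edge_up_or_inlevel x w : e x w -> w \notin back x -> d w = d x \/ x \in back w.
Proof.
move=> exw; rewrite !in_back exw e_sym exw /= => nw.
by case: (edge_levels exw) nw => ->; rewrite ?eqxx; [left|by []|right].
Qed.

(** For [z] a backward neighbour of [a], the common neighbours of [z] with [x] and with [x'] are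
    exactly [a] and [b]. So [parallel] gives [x] and [x'] a further common neighbour, which is not
    backward. *)
Lemma parallel_same_back x x' a b : 2 <= d x -> a != b -> x != x' -> ~~ e x x' ->
  back x = [set a; b] -> back x' = [set a; b] ->
  exists w, [/\ e x w, e x' w & d w = d x \/ x \in back w /\ x' \in back w].
Proof.
move=> dx nab nxx' nexx' bx bx'.
have : a \in back x by rewrite bx set21.
rewrite in_back => /andP[exa /eqP dxa].
have : a \in back x' by rewrite bx' set21.
rewrite in_back => /andP[_ /eqP dxa'].
have [|z eaz da] := d_pred (x := a); first by lia.
have dxz : d x = (d z).+2 by lia.
have dx'z : d x' = (d z).+2 by lia.
rewrite e_sym in exa; rewrite e_sym in eaz.
(* The second path from [z] to [x] avoids [a], so it passes through [b]. *)
have ezb : e z b.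
  have [u [nu ezu]] := second_path_two_levels dxz eaz exa.
  by rewrite bx in_set2 (negPf nu) => /eqP <-.
have common y w : d y = (d z).+2 -> back y = [set a; b] -> e z w -> e y w = (w \in [:: a; b]).
  move=> dyz byab ezw; have -> : (w \in [:: a; b]) = (w \in back y) by rewrite byab !inE.
  rewrite in_back; case eyw: (e y w) => //=.
  by rewrite dyz (common_two_levels dyz ezw) ?eqxx // e_sym.
have nz y : d y = (d z).+2 -> z != y by move=> dy; apply/eqP => zy; move: dy; rewrite zy; lia.
have [||||w [nw exw ex'w]] :=
  @parallel z x x' a b (nz _ dxz) (nz _ dx'z) nxx' (level_nonadjacent dxz)
    (level_nonadjacent dx'z) nexx' nab.
- by move=> w; apply: common.
- by move=> w; apply: common.
- by [].
- by [].
exists w; split=> //.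
have nwx : w \notin back x by rewrite bx; move: nw; rewrite !inE.
have nwx' : w \notin back x' by rewrite bx'; move: nw; rewrite !inE.
case: (edge_up_or_inlevel exw nwx) => [|xw]; first by left.
case: (edge_up_or_inlevel ex'w nwx') => [dw|x'w]; [by left; rewrite dxz -dx'z|by right].
Qed.

Lemma level0 : level 0 = [set v].
Proof. by apply/setP => x; rewrite in_level d_eq0 inE. Qed.

Lemma set_of_card2 (A : {set T}) a b : #|A| = 2 -> a \in A -> b \in A -> a != b -> A = [set a; b].
Proof.
move=> cA aA bA nab; apply/esym/eqP; rewrite eqEcard cA cards2 nab andbT.
by apply/subsetP => z; rewrite in_set2 => /orP[]/eqP->.
Qed.

(** ** A root of degree 2 *)

Section Candle.
Hypothesis card_odd : odd #|T|.
Hypothesis level1_card : #|level 1| = 2.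
Hypothesis inlevel_card : #|inlevel| = 2.
Hypothesis back_card : forall x, 2 <= d x -> #|back x| = 2.

Lemma inlevel_no_cherry x y z : (x, y) \in inlevel -> (y, z) \in inlevel -> x = z.
Proof.
move=> xy yz; have [[yx zy]|[]] := inlevel_two inlevel_card xy yz => //.
by have := inlevel_neq xy; rewrite yx eqxx.
Qed.

(** The common neighbour from [parallel_same_back] cannot share the level of [x], where it would end
    two inner edges; so it lies one level up, and [x], [x'] are its two backward neighbours. *)
Lemma candle_nonadjacent_pair x x' a b : 2 <= d x -> a != b -> x != x' -> ~~ e x x' ->
  back x = [set a; b] -> back x' = [set a; b] -> exists y, back y = [set x; x'].
Proof.
move=> dx nab nxx' nexx' bx bx'.
have [w [exw ex'w dw]] := parallel_same_back dx nab nxx' nexx' bx bx'.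
have aab : a \in [set a; b] by rewrite set21.
have : a \in back x by rewrite bx.
have : a \in back x' by rewrite bx'.
rewrite !in_back => /andP[_ /eqP dx'] /andP[_ /eqP dxa].
case: dw => [dw|[xw x'w]].
  case/eqP: nxx'; apply: (@inlevel_no_cherry _ w); rewrite in_inlevel ?exw ?dw ?eqxx //.
  by rewrite e_sym ex'w dx' dxa eqxx.
exists w; apply: set_of_card2 => //; apply: back_card.
by move: xw; rewrite in_back => /andP[_ /eqP->]; lia.
Qed.

(** Nonadjacent [y] and [y'] would have a common neighbour besides [x1]. It is not backward since
    [x2] and [x3] differ, not on their level by [inlevel_no_cherry], and one level up [back2_eq]
    would force [back y = back y']. *)
Lemma candle_next_adjacent x1 x2 x3 y y' : 1 <= d x1 -> x1 != x2 -> x1 != x3 -> x2 != x3 ->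
  back y = [set x1; x2] -> back y' = [set x1; x3] -> (y, y') \in inlevel.
Proof.
move=> dx1 n12 n13 n23 byy byy'.
have : x1 \in back y by rewrite byy set21.
have : x1 \in back y' by rewrite byy' set21.
rewrite !in_back => /andP[ey'x /eqP dy'] /andP[eyx /eqP dy].
rewrite in_inlevel dy dy' eqxx andbT; apply: contraT => neyy'.
have x2y' : x2 \in back y' -> False.
  by rewrite byy' in_set2 (negPf n23) eq_sym (negPf n12).
have nyy' : y != y'.
  by apply/eqP => yy'; apply: x2y'; rewrite -yy' byy set22.
have [w [nw eyw ey'w]] := second_common nyy' neyy' eyx ey'x.
have back_common : w \in back y -> w \in back y' -> false.
  rewrite byy byy' !in_set2 (negPf nw) /= => /eqP->.
  by rewrite (negPf n23).
have [wy|wy] := boolP (w \in back y).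
  apply: back_common => //; rewrite in_back ey'w dy' /=.
  by move: wy; rewrite in_back dy => /andP[].
have [dw|yw] := edge_up_or_inlevel eyw wy.
  case/eqP: nyy'; apply: (@inlevel_no_cherry _ w); rewrite in_inlevel ?eyw ?dw ?eqxx //.
  by rewrite e_sym ey'w dy' dy eqxx.
have dw : d w = (d y).+1 by move: yw; rewrite in_back => /andP[_ /eqP].
have y'w : y' \in back w by rewrite in_back e_sym ey'w dw dy dy' eqxx.
have dw2 : 2 <= d w by rewrite dw dy.
have bw := set_of_card2 (back_card dw2) yw y'w nyy'.
by case: x2y'; rewrite -(back2_eq dw2 bw) byy set22.
Qed.

(** Each of the three is adjacent to another one, which gives two inner edges with a common end. *)
Lemma candle_no_triple x1 x2 x3 a b : 2 <= d x1 -> a != b ->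
  x1 != x2 -> x1 != x3 -> x2 != x3 ->
  back x1 = [set a; b] -> back x2 = [set a; b] -> back x3 = [set a; b] -> False.
Proof.
move=> dx nab.
have dback x y : back x = [set a; b] -> back y = [set a; b] -> d x = d y.
  move=> bx b_y; have : a \in back x by rewrite bx set21.
  have : a \in back y by rewrite b_y set21.
  by rewrite !in_back => /andP[_ /eqP->] /andP[_ /eqP->].
have dxy x y z : d x = d x1 -> x != y -> x != z -> y != z ->
    back x = [set a; b] -> back y = [set a; b] -> back z = [set a; b] ->
    e x y || e x z.
  (* Otherwise [w] and [w'], above the two pairs at [x], form the only inner edge. So [y] and [z]
     are nonadjacent and have some [w''] above them, also adjacent to [w]; then [w'' = w'], although
     [x] is not in [back w'']. *)
  move=> dxx nxy nxz nyz bx by1 bz; apply: contraT; rewrite negb_or => /andP[nexy nexz].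
  have dx2 : 2 <= d x by rewrite dxx.
  have [w bw] := candle_nonadjacent_pair dx2 nab nxy nexy bx by1.
  have [w' bw'] := candle_nonadjacent_pair dx2 nab nxz nexz bx bz.
  have ww' := candle_next_adjacent (ltnW dx2) nxy nxz nyz bw bw'.
  have dy2 : 2 <= d y by rewrite (dback _ _ by1 bx).
  have dw : d w = (d x).+1.
    have : x \in back w by rewrite bw set21.
    by rewrite in_back => /andP[_ /eqP].
  have neyz : ~~ e y z.
    apply/negP => eyz.
    have yz : (y, z) \in inlevel by rewrite in_inlevel eyz (dback _ _ by1 bz) eqxx.
    have dyx := dback _ _ by1 bx; have dzx := dback _ _ bz bx.
    by have [[yw _]|[_ zw]] := inlevel_two inlevel_card ww' yz; move: dw;
      rewrite -?yw -?zw ?dyx ?dzx => /n_Sn.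
  have [w'' bw''] := candle_nonadjacent_pair dy2 nab nyz neyz by1 bz.
  have nyx : y != x by rewrite eq_sym.
  rewrite setUC in bw.
  have ww'' := candle_next_adjacent (ltnW dy2) nyx nyz nxz bw bw''.
  rewrite inlevelC in ww''.
  have w''w' := inlevel_no_cherry ww'' ww'.
  have : x \in back w'' by rewrite w''w' bw' set21.
  by rewrite bw'' in_set2 (negPf nxy) (negPf nxz).
move=> n12 n13 n23 b1 b2 b3.
have n21 : x2 != x1 by rewrite eq_sym.
have n31 : x3 != x1 by rewrite eq_sym.
have n32 : x3 != x2 by rewrite eq_sym.
have il x y : back x = [set a; b] -> back y = [set a; b] -> e x y -> (x, y) \in inlevel.
  by move=> bx by1 exy; rewrite in_inlevel exy (dback _ _ bx by1) eqxx.
have E1 := dxy _ _ _ erefl n12 n13 n23 b1 b2 b3.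
have E2 := dxy _ _ _ (dback _ _ b2 b1) n21 n23 n13 b2 b1 b3.
have E3 := dxy _ _ _ (dback _ _ b3 b1) n31 n32 n12 b3 b1 b2.
have N x y z : back x = [set a; b] -> back y = [set a; b] -> back z = [set a; b] ->
    x != z -> e x y -> e y z -> False.
  move=> bx by1 bz nxz exy eyz; case/eqP: nxz.
  exact: inlevel_no_cherry (il _ _ bx by1 exy) (il _ _ by1 bz eyz).
have [e12|] := boolP (e x1 x2).
  by case/orP: E3 => E3; [apply: (N x3 x1 x2)|apply: (N x3 x2 x1)] => //; rewrite e_sym.
move=> ne12; move: E1 E2; rewrite (e_sym x2 x1) (negPf ne12) /= => e13 e23.
by apply: (N x1 x3 x2) => //; rewrite e_sym.
Qed.

(** By induction every vertex of the next level has the whole level below as backward neighbourhood.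
    Three such vertices are excluded by [candle_no_triple], a single one by parity. *)
Lemma candle_level_card k : (exists x, d x = k.+1) -> #|level k.+1| = 2.
Proof.
elim/ltn_ind: k => -[|m] IH [x dx]; first exact: level1_card.
have lowers j : j <= m -> #|level j.+1| = 2.
  move=> jm; apply: (IH j); first by rewrite ltnS.
  by apply: (level_below (x := x)); lia.
have lm := lowers m (leqnn m).
have backE y : y \in level m.+2 -> back y = level m.+1.
  rewrite in_level => /eqP dy; apply/eqP; rewrite eqEcard lm back_card ?dy // andbT.
  by apply/subsetP => z; rewrite in_back in_level dy eqSS eq_sym => /andP[].
have /cards2P[a [b [nab lab]]] : #|level m.+1| == 2 by rewrite lm.
have xl : x \in level m.+2 by rewrite in_level dx.
(* A level with one vertex is the last, as vertices beyond it need two backward neighbours; the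
   order would be [1 + 2 (m + 1) + 1], which is even. *)
have [c1|c2] := leqP #|level m.+2| 1.
  have c1' : #|level m.+2| = 1.
    by apply/eqP; rewrite eqn_leq c1 card_gt0; apply/set0Pn; exists x.
  have top y : d y < m.+3.
    rewrite ltnNge; apply/negP => /level_below[z dz].
    have dz2 : 2 <= d z by lia.
    have := back_card dz2.
    have /subset_leq_card : back z \subset level m.+2.
      by apply/subsetP => u; rewrite in_back in_level dz eqSS eq_sym => /andP[].
    by rewrite c1' => /[swap] ->.
  move: card_odd; rewrite (card_level_sum top) big_ord_recr big_ord_recl /= level0 cards1 c1'.
  rewrite (eq_bigr (fun=> 2)) => [|j _]; last by rewrite lowers // -ltnS.
  by rewrite sum_nat_const; lia.
apply/eqP; rewrite eqn_leq c2 andbT leqNgt; apply/negP => c3.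
have /card_gt2P[x1 [x2 [x3 [[l1 l2 l3] [n12 n23 n31]]]]] := c3.
apply: (@candle_no_triple x1 x2 x3 a b) => //; rewrite -?lab ?backE //.
  by move: l1; rewrite in_level => /eqP->.
by rewrite eq_sym.
Qed.

Lemma candle_back_level x k : d x = k.+2 -> back x = level k.+1.
Proof.
move=> dx; apply/eqP; rewrite eqEcard back_card ?dx // candle_level_card ?andbT //; last first.
  by apply: (level_below (x := x)); rewrite dx.
by apply/subsetP => z; rewrite in_back in_level dx eqSS eq_sym => /andP[].
Qed.

Lemma candle_consecutive x y : d y = (d x).+1 -> e x y.
Proof.
case dx: (d x) => [|k] dy.
  by move/eqP: dx; rewrite d_eq0 => /eqP->; rewrite nbr_v dy.
have : x \in back y by rewrite (candle_back_level dy) in_level dx.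
by rewrite in_back e_sym => /andP[].
Qed.

Variable K : nat.
Hypothesis K_gt0 : 0 < K.
Hypothesis K_max : forall x, d x <= K.
Hypothesis K_reached : exists x, d x = K.

Lemma candle_order : #|T| = K.*2.+1.
Proof.
have top x : d x < K.+1 by rewrite ltnS.
rewrite (card_level_sum top) big_ord_recl /= level0 cards1 (eq_bigr (fun=> 2)) => [|j _].
  by rewrite sum_nat_const card_ord muln2.
rewrite /bump leq0n add1n candle_level_card //; have [x dx] := K_reached.
by apply: (level_below (x := x)); rewrite dx.
Qed.

(** Nonadjacent [x] and [y] would need a further common neighbour: on level 1 if [K = 1], ending two
    inner edges, and otherwise beyond the last level. *)
Lemma candle_last_level x y : d x = K -> d y = K -> x != y -> e x y.
Proof.
case: K K_gt0 K_max => // -[|k] _ top dx dy nxy; apply: contraT => nexy.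
  have [||w [nw exw eyw]] := @second_common x y v nxy nexy.
  - by rewrite e_sym nbr_v dx.
  - by rewrite e_sym nbr_v dy.
  have dw : d w = 1.
    have := top w; rewrite leq_eqVlt ltnS leqn0 d_eq0 (negPf nw) orbF => /eqP->//.
  case/eqP: nxy; apply: (@inlevel_no_cherry _ w); first by rewrite in_inlevel exw dx dw.
  by rewrite in_inlevel e_sym eyw dy dw.
have ck : #|level k.+1| = 2.
  by apply: candle_level_card; apply: (level_below (x := x)); rewrite dx.
have /cards2P[a [b [nab lab]]] : #|level k.+1| == 2 by rewrite ck.
have dx2 : 2 <= d x by rewrite dx.
have [||w bw] := candle_nonadjacent_pair dx2 nab nxy nexy.
- by rewrite (candle_back_level dx).
- by rewrite (candle_back_level dy).
have : x \in back w by rewrite bw set21.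
by rewrite in_back dx => /andP[_ /eqP dw]; have := top w; rewrite dw ltnn.
Qed.

Lemma candle_adjacency x y : e x y =
  (x != y) && [|| (d x).+1 == d y, (d y).+1 == d x | (d x == K) && (d y == K)].
Proof.
apply/idP/andP => [exy|[nxy /or3P[/eqP dy|/eqP dx|/andP[/eqP dx /eqP dy]]]]; last 3 first.
- exact: candle_consecutive.
- by rewrite e_sym candle_consecutive.
- exact: candle_last_level.
split; first exact: edge_neq.
case: (edge_levels exy) => dxy; rewrite ?dxy ?eqxx ?orbT // andbb.
have [z dz] := K_reached.
have /cards2P[p [q [npq lK]]] : #|level K| == 2.
  by case: K K_gt0 dz => // k _ dz; rewrite candle_level_card //; exists z.
have : p \in level K by rewrite lK set21.
have : q \in level K by rewrite lK set22.
rewrite !in_level => /eqP dq /eqP dp.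
have pq : (p, q) \in inlevel by rewrite in_inlevel candle_last_level ?dp ?dq ?eqxx.
have xy : (x, y) \in inlevel by rewrite in_inlevel exy dxy eqxx.
have [[_ ->]|[_ ->]] := inlevel_two inlevel_card pq xy; first by rewrite dq eqxx !orbT.
by rewrite dp eqxx !orbT.
Qed.

End Candle.

Lemma back_lt x y : y \in back x -> d x = (d y).+1.
Proof. by rewrite in_back => /andP[_ /eqP]. Qed.

Lemma inlevel_eq x y : (x, y) \in inlevel -> d x = d y.
Proof. by rewrite in_inlevel => /andP[_ /eqP]. Qed.

Lemma back_sub_level x k : d x = k.+1 -> back x \subset level k.
Proof. by move=> dx; apply/subsetP => y /back_lt; rewrite dx in_level => -[->]. Qed.

Lemma avoid_subset (A B : {set T}) : #|B| < #|A| -> exists2 u, u \in A & u \notin B.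
Proof.
move=> lt; apply/subsetPn; apply: contraTN lt => /subset_leq_card.
by rewrite leqNgt => /negP ? ; apply/negP.
Qed.

Lemma common_levels12 a x w : d a = 1 -> d x = 2 -> e a w -> e x w ->
  ((a, w) \in inlevel /\ w \in back x) \/ (x, w) \in inlevel.
Proof.
move=> da dx eaw exw; rewrite !in_inlevel in_back eaw exw da dx /=.
case: (edge_levels eaw) => [dw|dw|dw].
- by left; rewrite -dw da.
- by rewrite da in dw; case: dw => dw; case: (edge_levels exw); rewrite dx -dw.
- by right; rewrite dw da.
Qed.

(** [a] and [x] are nonadjacent with common neighbour [x']; their second common neighbour yields
    another inner edge, at [a] on level 1 or at [x] on level 2. *)
Lemma inlevel_distinct_back x x' a : d x = 2 -> (x, x') \in inlevel ->
  a \in back x' -> a \notin back x ->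
  (exists2 w, (a, w) \in inlevel & w \in back x) \/
  (exists2 w, (w, x) \in inlevel & w != x').
Proof.
move=> dx xx' ax' nax.
have da : d a = 1 by have := back_lt ax'; rewrite -(inlevel_eq xx') dx => -[].
have neax : ~~ e a x by move: nax; rewrite in_back dx da eqxx andbT e_sym.
have nax2 : a != x by apply/eqP => ax; move: dx; rewrite -ax da.
have eax' : e a x' by move: ax'; rewrite in_back e_sym => /andP[].
have exx' : e x x' by move: xx'; rewrite in_inlevel => /andP[].
have [w [nw eaw exw]] := second_common nax2 neax eax' exx'.
case: (common_levels12 da dx eaw exw) => [[aw wx]|xw]; [left|right]; exists w => //.
by rewrite inlevelC.
Qed.

(** ** A root of degree 3 *)

Section Cubic.
Hypothesis card_odd : odd #|T|.
Hypothesis level1_card : #|level 1| = 3.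
Hypothesis degree_ge3 : forall x, 3 <= #|[set y | e x y]|.

(** Otherwise the order is 1 + 3, which is even. *)
Lemma level2_inhabited : exists x, d x = 2.
Proof.
case: (pickP [pred x | d x == 2]) => [x /eqP dx|no2]; first by exists x.
have top x : d x < 2.
  by rewrite ltnNge; apply/negP => /level_below[y] /eqP; have /= -> := no2 y.
by move: card_odd; rewrite (card_level_sum top) big_ord_recl big_ord1 level0 cards1 level1_card.
Qed.

Lemma degree_avoid x a b : exists2 u, e x u & u \notin [set a; b].
Proof.
have [|u] := @avoid_subset [set y | e x y] [set a; b].
  by apply: leq_trans (degree_ge3 x); rewrite ltnS cards2; case: (a != b).
by rewrite inE; exists u.
Qed.

(** Two pairs among three vertices of level 1 meet, so nonadjacent [x1] and [x2] have a second
    common neighbour. It is not backward, as the pairs differ; if it lies above, [back2_eq] forbids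
    it exactly two backward neighbours. *)
Lemma level2_share x1 x2 : d x1 = 2 -> d x2 = 2 -> #|back x1| = 2 -> #|back x2| = 2 ->
  back x1 != back x2 ->
  [\/ (x1, x2) \in inlevel,
      exists2 w, (x1, w) \in inlevel & (w, x2) \in inlevel |
      exists w, [/\ d w = 3, x1 \in back w, x2 \in back w & #|back w| != 2]].
Proof.
move=> d1 d2 c1 c2 nb.
have [c] : exists c, c \in back x1 :&: back x2.
  apply/set0Pn; rewrite -card_gt0.
  have := cardsUI (back x1) (back x2).
  have : #|back x1 :|: back x2| <= 3.
    by rewrite -level1_card subset_leq_card // subUset !back_sub_level.
  rewrite c1 c2; case: #|back x1 :&: back x2| => //.
  by rewrite addn0 => /[swap] ->.
rewrite in_setI => /andP[cx1 cx2].
have [e12|ne12] := boolP (e x1 x2); first by constructor 1; rewrite in_inlevel e12 d1 d2.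
have n12 : x1 != x2 by apply: contraNneq nb => ->.
have [||w [nw e1w e2w]] := second_common n12 ne12 (w := c).
- by move: cx1; rewrite in_back => /andP[].
- by move: cx2; rewrite in_back => /andP[].
have [w1|w1] := boolP (w \in back x1).
  have w2 : w \in back x2 by move: w1; rewrite !in_back e2w d1 d2 => /andP[].
  by rewrite (set_of_card2 c1 w1 cx1 nw) (set_of_card2 c2 w2 cx2 nw) eqxx in nb.
have [dw|w1'] := edge_up_or_inlevel e1w w1.
  constructor 2; exists w; rewrite in_inlevel ?e1w dw ?eqxx //.
  by rewrite e_sym e2w d1 d2.
have dw : d w = 3 by rewrite (back_lt w1') d1.
have w2' : x2 \in back w by rewrite in_back e_sym e2w dw d2.
constructor 3; exists w; split=> //; apply/eqP => cw.
have bw := set_of_card2 cw w1' w2' n12.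
by rewrite (back2_eq _ bw) ?dw ?eqxx in nb.
Qed.

(** Take [c] on level 1 outside [back x1]. Either [c] is a backward neighbour of some vertex of
    level 2, or minimum degree 3 forces two neighbours of [c] inside level 1. *)
Lemma level2_two_types x1 : d x1 = 2 -> #|back x1| = 2 ->
  (exists2 x2, d x2 = 2 & back x1 != back x2) \/
  exists c p q, [/\ d c = 1, p != q, (c, p) \in inlevel & (c, q) \in inlevel].
Proof.
move=> d1 c1.
have [|c] := @avoid_subset (level 1) (back x1); first by rewrite level1_card c1.
rewrite in_level => /eqP dc nc.
case: (pickP [pred x | (d x == 2) && (c \in back x)]) => [x /andP[/eqP dx cx]|noX].
  by left; exists x => //; apply: contraNneq nc => ->.
right; have [p ecp] := degree_avoid c v v.
rewrite setUid inE => npv.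
have [q ecq] := degree_avoid c v p.
rewrite in_set2 negb_or => /andP[nqv nqp].
have inl u : e c u -> u != v -> (c, u) \in inlevel.
  move=> ecu nuv; rewrite in_inlevel ecu dc /=.
  case: (edge_levels ecu) => du; first by rewrite -du dc.
    by move: nuv; rewrite -d_eq0; move: du; rewrite dc => -[<-].
  by have := noX u; rewrite /= in_back e_sym ecu du dc.
by exists c, p, q; rewrite dc eq_sym nqp !inl.
Qed.

Lemma back_sub_eq x y : #|back x| = 2 -> #|back y| = 2 ->
  (forall a, a \in back x -> a \notin back y -> False) -> back x = back y.
Proof.
move=> cx cy sub; apply/eqP; rewrite eqEcard cx cy andbT; apply/subsetP => a ax.
by apply: contraT => /(sub a ax).
Qed.

Lemma back_neq_mem x y : #|back x| = 2 -> #|back y| = 2 -> back x != back y ->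
  exists2 a, a \in back x & a \notin back y.
Proof.
move=> cx cy nxy; apply/subsetPn; apply: contraNN nxy => xy.
by rewrite eqEcard xy cx cy.
Qed.

(** * One inner edge and one vertex with three backward neighbours *)

Section OneInlevelEdge.
Hypothesis inlevel_card : #|inlevel| = 2.
Variable x0 : T.
Hypothesis back_x0 : #|back x0| = 3.
Hypothesis back_card : forall x, x != x0 -> 2 <= d x -> #|back x| = 2.

Let no_cherry := inlevel_no_cherry inlevel_card.

Let inlevel_same_level p q x y : (p, q) \in inlevel -> (x, y) \in inlevel -> d x = d p.
Proof.
by move=> pq xy; have [[-> _]|[-> _]] := inlevel_two inlevel_card pq xy; rewrite ?(inlevel_eq pq).
Qed.

Let inlevel_same_back x x' : d x = 2 -> x != x0 -> x' != x0 -> (x, x') \in inlevel ->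
  back x = back x'.
Proof.
move=> dx nx nx' xx'; have dx' := inlevel_eq xx'; rewrite dx in dx'.
apply/esym/back_sub_eq; rewrite ?back_card -?dx' ?dx // => a ax' nax.
have da : d a = 1 by have := back_lt ax'; rewrite -dx' => -[].
have [[w aw _]|[w wx]] := inlevel_distinct_back dx xx' ax' nax.
  by have := inlevel_same_level xx' aw; rewrite da dx.
by rewrite (no_cherry wx xx') eqxx.
Qed.

Let share x1 x2 : d x1 = 2 -> d x2 = 2 -> x1 != x0 -> x2 != x0 -> back x1 != back x2 ->
  [/\ d x0 = 3, x1 \in back x0 & x2 \in back x0].
Proof.
move=> d1 d2 n1 n2 nb.
have c1 : #|back x1| = 2 by rewrite back_card ?d1.
have c2 : #|back x2| = 2 by rewrite back_card ?d2.
case: (level2_share d1 d2 c1 c2 nb) => [e12|[w w1 w2]|[w [dw w1 w2 cw]]].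
- by rewrite (inlevel_same_back d1 n1 n2 e12) eqxx in nb.
- by rewrite (no_cherry w1 w2) eqxx in nb.
have [<-//|nw] := eqVneq w x0.
by rewrite back_card ?dw ?eqxx in cw.
Qed.

Lemma cubic_triple_not_level2 : d x0 != 2.
Proof.
apply/eqP => dx0.
have /set0Pn[[p q] pq] : inlevel != set0 by rewrite -card_gt0 inlevel_card.
(* [r] lies on level 1 off the inner edge, so apart from the root its neighbours are on level 2. *)
have [|r] := @avoid_subset (level 1) [set p; q].
  by rewrite level1_card cards2; case: (p != q).
rewrite in_level in_set2 negb_or => /eqP dr /andP[nrp nrq].
have r_iso u : (r, u) \in inlevel -> False.
  move=> ru; have [[rp _]|[rq _]] := inlevel_two inlevel_card pq ru.
    by rewrite rp eqxx in nrp.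
  by rewrite rq eqxx in nrq.
have nbr_level c u : d c = 1 -> e c u -> u \notin [set v; x0] ->
    (c, u) \in inlevel \/ [/\ d u = 2, u != x0 & c \in back u].
  move=> dc ecu; rewrite in_set2 negb_or => /andP[nuv nu0].
  have [cu|nuc] := boolP (u \in back c).
    by move: cu; rewrite back_level1 // inE (negPf nuv).
  have [du|cu] := edge_up_or_inlevel ecu nuc; first by left; rewrite in_inlevel ecu du eqxx.
  by right; rewrite (back_lt cu) dc.
have [x1 erx1 nx1] := degree_avoid r v x0.
have [/r_iso//|[d1 n1 rx1]] := nbr_level _ _ dr erx1 nx1.
have c1 : #|back x1| = 2 by rewrite back_card ?d1.
(* By [share], [c] has no neighbour on level 2 except possibly [x0], so it is an end of the inner
   edge. A common neighbour of [c] and [x1] besides [u] would then require another inner edge. *)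
have [|c] := @avoid_subset (level 1) (back x1); first by rewrite level1_card c1.
rewrite in_level => /eqP dc nc.
have [u ecu nu] := degree_avoid c v x0.
have [cu|[du nu0 cu]] := nbr_level _ _ dc ecu nu; last first.
  have nb : back x1 != back u by apply: contraNneq nc => ->.
  by have [] := share d1 du n1 nu0 nb; rewrite dx0.
have back1 : back x1 = level 1 :\ c.
  have c3 : #|level 1 :\ c| = 2.
    by have := level1_card; rewrite (cardsD1 c) in_level dc => -[].
  apply/eqP; rewrite eqEcard c1 c3 leqnn andbT; apply/subsetP => z z1.
  rewrite in_setD1 (subsetP (back_sub_level d1)) // andbT.
  by apply: contraNneq nc => <-.
have eux1 : e x1 u.
  have : u \in back x1.
    by rewrite back1 in_setD1 eq_sym (inlevel_neq cu) in_level -(inlevel_eq cu) dc.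
  by rewrite in_back => /andP[].
have necx1 : ~~ e c x1 by move: nc; rewrite in_back d1 dc eqxx andbT e_sym.
have ncx1 : c != x1 by apply/eqP => cx; move: d1; rewrite -cx dc.
have [w [nw ecw ex1w]] := second_common ncx1 necx1 ecu eux1.
case: (common_levels12 dc d1 ecw ex1w) => [[cw _]|xw].
  by rewrite inlevelC in cw; rewrite (no_cherry cw cu) eqxx in nw.
by have := inlevel_same_level cu xw; rewrite d1 dc.
Qed.

(** Levels 0 to 3 turn out to have 1, 3, 3 and 1 vertices, and no level follows; the order 8 is
    even. *)
Lemma cubic_one_inlevel_edge : False.
Proof.
have nx0 x : d x = 2 -> x != x0 by move=> dx; apply: contraNneq cubic_triple_not_level2 => <-; rewrite dx.
have cback x : d x = 2 -> #|back x| = 2 by move=> dx; rewrite back_card ?nx0 ?dx.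
have [x1 d1] := level2_inhabited; have c1 := cback _ d1.
case: (level2_two_types d1 c1) => [[x2 d2 nb]|[c [p [q [_ npq cp cq]]]]]; last first.
  by rewrite inlevelC in cp; rewrite (no_cherry cp cq) eqxx in npq.
have c2 := cback _ d2.
have [d0 x10 x20] := share d1 d2 (nx0 _ d1) (nx0 _ d2) nb.
have n12 : x1 != x2 by apply: contraNneq nb => ->.
have [a a1 na2] := back_neq_mem c1 c2 nb.
have nb' : back x2 != back x1 by rewrite eq_sym.
have [b b2 nb1] := back_neq_mem c2 c1 nb'.
(* Second paths from level 1 to [x0]: the one from [a] avoids [x1] and [x2] and yields [x3]; the one
   from [b] avoids them too and also passes through [x3]. *)
have third z x : z \in back x -> x \in back x0 ->
    exists u, [/\ u != x, u \in back x0 & z \in back u].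
  move=> zx x_0; have dx := back_lt zx; have dxx := back_lt x_0.
  have d02 : d x0 = (d z).+2 by rewrite dxx dx.
  have ezx : e z x by move: zx; rewrite in_back e_sym => /andP[].
  have exx0 : e x x0 by move: x_0; rewrite in_back e_sym => /andP[].
  by have [u [nu _ u0 zu]] := second_path_two_levels d02 ezx exx0; exists u.
have [x3 [n31 x30 a3]] := third _ _ a1 x10.
have n32 : x3 != x2 by apply: contraNneq na2 => <-.
have back0 : back x0 = [set x1; x2; x3].
  apply/esym/eqP; rewrite eqEcard; apply/andP; split.
    by apply/subsetP => z; rewrite in_setU in_set2 in_set1 -orbA => /or3P[]/eqP->.
  rewrite back_x0 -setUA cardsU1 cards2 in_set2 negb_or n12.
  by rewrite (eq_sym x1 x3) n31 (eq_sym x2 x3) n32.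
have b3 : b \in back x3.
  have [u [nu2 u0 bu]] := third _ _ b2 x20.
  move: u0 bu; rewrite back0 in_setU in_set2 in_set1 (negPf nu2) orbF.
  by move=> /orP[]/eqP-> //; rewrite (negPf nb1).
have level2E : level 2 = back x0.
  apply/eqP; rewrite eqEsubset back_sub_level // andbT; apply/subsetP => x.
  rewrite in_level => /eqP dx; have [bx|bx] := eqVneq (back x) (back x1).
    have bx2 : back x != back x2 by rewrite bx.
    by have [] := share dx d2 (nx0 _ dx) (nx0 _ d2) bx2.
  by have [] := share dx d1 (nx0 _ dx) (nx0 _ d1) bx.
have inj p q : p \in back x0 -> q \in back x0 -> p != q -> back p = back q -> False.
  rewrite back0 !inE -!orbA.
  by move=> /or3P[]/eqP-> /or3P[]/eqP->; rewrite ?eqxx // => _ /setP bpq;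
    have := bpq a; have := bpq b; rewrite ?a1 ?(negPf na2) ?a3 ?b2 ?(negPf nb1) ?b3.
have level3 w : d w = 3 -> w = x0.
  move=> dw; apply/eqP; apply: contraT => nw0.
  have /cards2P[p [q [npq bw]]] : #|back w| == 2 by rewrite back_card ?dw.
  have sub z : z \in back w -> z \in back x0.
    by rewrite -level2E; apply/subsetP/back_sub_level.
  case: (@inj p q) => //; try by apply: sub; rewrite bw !inE eqxx ?orbT.
  by apply: back2_eq bw; rewrite dw.
have top y : d y < 4.
  rewrite ltnNge; apply/negP => /level_below[z dz].
  have : #|back z| <= #|[set x0]|.
    apply/subset_leq_card/subsetP => u /back_lt; rewrite dz => -[du].
    by rewrite inE (level3 u) -?du.
  by rewrite cards1 leqNgt card_back_ge2 ?dz.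
have level3E : level 3 = [set x0].
  apply/setP => w; rewrite in_level in_set1; apply/eqP/eqP => [/level3//|->//].
move: card_odd; rewrite (card_level_sum top) !big_ord_recl big_ord0 /=.
by rewrite level0 level1_card level2E level3E back_x0 !cards1.
Qed.

End OneInlevelEdge.

(** * Two inner edges and no surplus backward edge *)

Section TwoInlevelEdges.
Hypothesis inlevel_card : #|inlevel| = 4.
Hypothesis back_card : forall x, 2 <= d x -> #|back x| = 2.

Let cback x : d x = 2 -> #|back x| = 2.
Proof. by move=> dx; rewrite back_card ?dx. Qed.

(* Two in-level edges meeting in [w] on level 2 exhaust the in-level edges. *)
Let cherry_same_back x w y : d x = 2 -> x != y -> (x, w) \in inlevel -> (w, y) \in inlevel ->
  back x = back w.
Proof.
move=> dx nxy xw wy; have dw := inlevel_eq xw; rewrite dx in dw.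
have nxw := inlevel_neq xw; have nwy := inlevel_neq wy; have dy := inlevel_eq wy.
have n1 : (w, y) != (x, w) by rewrite xpair_eqE eq_sym (negPf nxw).
have n2 : (w, y) != (w, x) by rewrite xpair_eqE negb_and orbC eq_sym nxy.
apply/esym/back_sub_eq; rewrite ?cback -?dw // => a aw nax.
have da : d a = 1 by have := back_lt aw; rewrite -dw => -[].
move/eqP: nxy => nxy; move/eqP: nxw => nxw.
have [[u au _]|[u ux /eqP nu]] := inlevel_distinct_back dx xw aw nax.
  by have [] := inlevel_four inlevel_card xw wy n1 n2 au => -[] *; congruence.
by have [] := inlevel_four inlevel_card xw wy n1 n2 ux => -[] *; congruence.
Qed.

(** The edges at [c] are the only inner edges, so a vertex farthest from [v] has just two
    neighbours, against minimum degree 3. *)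
Let no_level1_cherry c p q : d c = 1 -> p != q ->
  (c, p) \in inlevel -> (c, q) \in inlevel -> False.
Proof.
move=> dc npq cp cq; have dp := inlevel_eq cp; have dq := inlevel_eq cq.
have n1 : (c, q) != (c, p) by rewrite xpair_eqE negb_and orbC eq_sym npq.
have n2 : (c, q) != (p, c) by rewrite xpair_eqE negb_and (inlevel_neq cp).
have [w _ wmax] := @arg_maxnP T v xpredT d isT.
have [z dz] := level2_inhabited.
have dw : 2 <= d w by rewrite -dz; apply: wmax.
have [|u] := @avoid_subset [set y | e w y] (back w).
  by rewrite back_card.
rewrite inE => ewu nu; have [du|wu] := edge_up_or_inlevel ewu nu; last first.
  by have := wmax u isT; rewrite /= (back_lt wu) ltnn.
have wu : (w, u) \in inlevel by rewrite in_inlevel ewu du eqxx.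
have dw1 : d w <> 1 by move=> dw1; rewrite dw1 in dw.
by have [] := inlevel_four inlevel_card cp cq n1 n2 wu => -[] *; congruence.
Qed.

(** From both ends, [inlevel_distinct_back] locates the other inner edge: it meets [a] or [x2], and
    also [b] or [x1]. This is only possible if it joins [a] and [b]. *)
Let distinct_back_pair x1 x2 : d x1 = 2 -> (x1, x2) \in inlevel -> back x1 != back x2 ->
  exists a b, [/\ d a = 1, d b = 1 & (a, b) \in inlevel].
Proof.
move=> d1 e12 nb; have d2 := inlevel_eq e12; rewrite d1 in d2.
have e21 : (x2, x1) \in inlevel by rewrite inlevelC.
have c1 := cback d1; have c2 := cback (esym d2).
have nb' : back x2 != back x1 by rewrite eq_sym.
have [a a1 na2] := back_neq_mem c1 c2 nb.
have [b b2 nb1] := back_neq_mem c2 c1 nb'.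
have da : d a = 1 by have := back_lt a1; rewrite d1 => -[].
have db : d b = 1 by have := back_lt b2; rewrite -d2 => -[].
have n12 := inlevel_neq e12.
have /eqP n12' := n12.
have nab : b <> a by move=> ba; move: na2; rewrite -ba b2.
have [[w aw w2]|[w w2 nw]] := inlevel_distinct_back (esym d2) e21 a1 na2;
have [[w' bw' w'1]|[w' w'1 /eqP nw']] := inlevel_distinct_back d1 e12 b2 nb1.
- have m1 : (a, w) != (x1, x2) by rewrite xpair_eqE; apply: contra_eqN d1 => /andP[/eqP<- _]; rewrite da.
  have m2 : (a, w) != (x2, x1) by rewrite xpair_eqE; apply: contra_eqN d2 => /andP[/eqP<- _]; rewrite da.
  exists a, b; split=> //.
  have [] := inlevel_four inlevel_card e12 aw m1 m2 bw' => -[bE _].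
  + by move: db; rewrite bE d1.
  + by move: db; rewrite bE -d2.
  + by case: nab.
  + by rewrite bE.
- have m1 : (a, w) != (x1, x2) by rewrite xpair_eqE; apply: contra_eqN d1 => /andP[/eqP<- _]; rewrite da.
  have m2 : (a, w) != (x2, x1) by rewrite xpair_eqE; apply: contra_eqN d2 => /andP[/eqP<- _]; rewrite da.
  have dw := inlevel_eq aw.
  by have [] := inlevel_four inlevel_card e12 aw m1 m2 w'1 => -[] *; congruence.
- have m1 : (w, x2) != (x1, x2) by rewrite xpair_eqE (negPf nw).
  have m2 : (w, x2) != (x2, x1) by rewrite xpair_eqE negb_and orbC eq_sym n12.
  have dw := inlevel_eq w2.
  by have [] := inlevel_four inlevel_card e12 w2 m1 m2 bw' => -[] *; congruence.
have m1 : (w, x2) != (x1, x2) by rewrite xpair_eqE (negPf nw).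
have m2 : (w, x2) != (x2, x1) by rewrite xpair_eqE negb_and orbC eq_sym n12.
move/eqP: nw => nw.
by have [] := inlevel_four inlevel_card e12 w2 m1 m2 w'1 => -[] *; congruence.
Qed.

Let share x1 x2 : d x1 = 2 -> d x2 = 2 -> back x1 != back x2 -> (x1, x2) \in inlevel.
Proof.
move=> d1 d2 nb.
case: (level2_share d1 d2 (cback d1) (cback d2) nb) => [//|[w w1 w2]|[w [dw _ _ cw]]]; last first.
  by rewrite back_card ?dw in cw.
have n12 : x1 != x2 by apply: contraNneq nb => ->.
have n21 : x2 != x1 by rewrite eq_sym.
move: nb; rewrite (cherry_same_back d1 n12 w1 w2).
by rewrite (cherry_same_back d2 n21 (w := w)) ?eqxx // inlevelC.
Qed.

(** Levels 0 to 2 have 1, 3 and 2 vertices. A vertex of level 3 would have [x1] and [x2] as backward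
    neighbours, against [back2_eq]; so the order is 6, which is even. *)
Lemma cubic_two_inlevel_edges : False.
Proof.
have [x1 d1] := level2_inhabited.
case: (level2_two_types d1 (cback d1)) => [[x2 d2 nb]|[c [p [q [dc npq cp cq]]]]]; last first.
  exact: no_level1_cherry cp cq.
have e12 := share d1 d2 nb; have n12 := inlevel_neq e12.
have [a [b [da db ab]]] := distinct_back_pair d1 e12 nb.
have m1 : (a, b) != (x1, x2).
  by rewrite xpair_eqE; apply: contra_eqN d1 => /andP[/eqP<- _]; rewrite da.
have m2 : (a, b) != (x2, x1).
  by rewrite xpair_eqE; apply: contra_eqN d2 => /andP[/eqP<- _]; rewrite da.
have level2E : level 2 = [set x1; x2].
  apply/esym/eqP; rewrite eqEsubset; apply/andP; split; apply/subsetP => x.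
    by rewrite in_set2 in_level => /orP[]/eqP->; rewrite ?d1 ?d2.
  rewrite in_level in_set2 => /eqP dx.
  have inl u : (x, u) \in inlevel -> (x == x1) || (x == x2).
    by move=> xu; have [] := inlevel_four inlevel_card e12 ab m1 m2 xu => -[] *; subst;
       rewrite ?eqxx ?orbT //; congruence.
  have [bx|bx] := eqVneq (back x) (back x1); last exact: inl (share dx d1 bx).
  by apply: (inl x2); apply: share; rewrite ?bx.
have top y : d y < 3.
  rewrite ltnNge; apply/negP => /level_below[w dw].
  have bw : back w = [set x1; x2].
    apply/eqP; rewrite eqEcard back_card ?dw // cards2 n12 -level2E andbT.
    exact: back_sub_level.
  by move: nb; rewrite (back2_eq _ bw) ?eqxx ?dw.
move: card_odd; rewrite (card_level_sum top) !big_ord_recl big_ord0 /=.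
by rewrite level0 level1_card level2E cards1 cards2 n12.
Qed.

End TwoInlevelEdges.

End Cubic.

End Levels.

(** * Odd order and 2n - 3 edges *)

Lemma candle_labelling n (d : 'I_n -> nat) K :
  n = K.*2.+1 -> (forall x, d x <= K) -> #|[set x | d x == 0]| <= 1 ->
  (forall k, #|[set x | d x == k.+1]| <= 2) ->
  exists f : {perm 'I_n}, forall x, ((f x).+1)./2 = d x.
Proof.
move=> nK dK c0 c2.
pose second (x : 'I_n) := [exists z : 'I_n, (d z == d x) && (z < x)].
(* Level [k.+1] of the candle consists of [k.*2.+1] and [k.*2.+2]; a vertex preceded by another of
   its level takes the larger label. *)
pose g x := if d x is k.+1 then k.*2.+1 + second x else 0.
have gn x : g x < n.
  by rewrite nK /g; have := dK x; case: (d x) => // k; case: (second x); lia.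
have half x : (g x).+1./2 = d x.
  by rewrite /g; case: (d x) => // k; case: (second x); lia.
have ord_lt_neq (x y : 'I_n) : x < y -> x != y.
  by move=> xy; rewrite -val_eqE /= ltn_eqF.
have lt_second (x y : 'I_n) : x < y -> g x = g y -> False.
  move=> xy gxy; have dxy : d x = d y by rewrite -!half gxy.
  case dx: (d x) => [|k].
    move: c0; rewrite leqNgt => /negP; apply; apply/card_gt1P; exists x, y.
    by rewrite !inE -dxy dx ord_lt_neq.
  have sy : second y by apply/existsP; exists x; rewrite dxy eqxx.
  have /existsP[z /andP[/eqP dz zx]] : second x.
    by move: gxy; rewrite /g -dxy dx sy; case: (second x) => // /eqP; rewrite eqn_add2l.
  have := c2 k; rewrite leqNgt => /negP; apply; apply/card_gt2P; exists x, y, z.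
  rewrite !inE -dxy dz dx !eqxx (ord_lt_neq _ _ xy) (ord_lt_neq _ _ zx) (eq_sym y z).
  by rewrite (ord_lt_neq _ _ (ltn_trans zx xy)).
have g_inj : injective (fun x => Ordinal (gn x)).
  move=> x y [gxy]; apply/val_inj; case: (ltngtP x y) => // lt; case: (lt_second _ _ lt) => //.
exists (perm g_inj) => x; rewrite permE; exact: half.
Qed.

Lemma sum_nat_one (T : finType) (P : pred T) (F : T -> nat) : \sum_(x | P x) F x = 1 ->
  exists x0, [/\ P x0, F x0 = 1 & forall x, P x -> x != x0 -> F x = 0].
Proof.
move=> s1; case: (pickP [pred x | P x && (F x != 0)]) => [x0 /andP[Px0 Fx0]|no].
  move: s1; rewrite (bigD1 x0) //= => s1.
  have Fx1 : F x0 = 1 by lia.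
  exists x0; split=> // x Px nx; have : \sum_(i | P i && (i != x0)) F i == 0 by lia.
  by rewrite sum_nat_eq0 => /forallP/(_ x); rewrite Px nx => /eqP.
by rewrite big1 // in s1 => x Px; have := no x; rewrite /= Px => /negbFE/eqP.
Qed.

Section Sparse.
Variables (n : nat) (e : rel 'I_n).
Hypothesis e_sym : symmetric e.
Hypothesis e_irr : irreflexive e.
Hypothesis e_conn : graph_connected e.
Hypothesis n_odd : odd n.
Hypothesis n_ge3 : 3 <= n.
Hypothesis edge_count : num_edges e = 2 * n - 3.
Hypothesis second_common : forall x y w, x != y -> ~~ e x y -> e x w -> e y w ->
  exists w', [/\ w' != w, e x w' & e y w'].
Hypothesis parallel : forall z x x' w1 w2,
  z != x -> z != x' -> x != x' -> ~~ e z x -> ~~ e z x' -> ~~ e x x' -> w1 != w2 ->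
  (forall w, e z w -> e x w = (w \in [:: w1; w2])) ->
  (forall w, e z w -> e x' w = (w \in [:: w1; w2])) ->
  e z w1 -> e z w2 ->
  exists w, [/\ w \notin [:: w1; w2], e x w & e x' w].
Hypothesis not_bipartite : forall c : 'I_n -> bool, ~ (forall x y, e x y -> c x != c y).

Let deg x := #|[set y | e x y]|.

Lemma sum_degrees : \sum_x deg x = 2 * (2 * n - 3).
Proof.
rewrite -edge_count -card_edge_pairs // card_rel_pairs.
by apply: eq_bigr => x _; rewrite /deg card_sum_nbr.
Qed.

Lemma exists_small_degree : exists v, deg v <= 3.
Proof.
case: (pickP [pred v | deg v <= 3]) => [v ?|no]; first by exists v.
have : \sum_(x < n) 4 <= \sum_x deg x.
  by apply: leq_sum => x _; rewrite ltnNge; have /= -> := no x.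
by rewrite sum_degrees sum_nat_const card_ord; lia.
Qed.

(** Inner edges exist because the parity of [d] is not a proper 2-colouring; the last identity is
    [excess] with [2n - 3] edges inserted. *)
Lemma distance_levels v : exists d : 'I_n -> nat,
  [/\ forall x, (d x == 0) = (x == v),
      forall x y, e x y -> d y <= (d x).+1,
      forall x, 0 < d x -> exists2 y, e x y & d x = (d y).+1,
      #|level d 1| = deg v /\ 0 < #|inlevel e d| &
      2 * deg v = #|inlevel e d| + 2 * \sum_(x | 2 <= d x) (#|back e d x| - 2) + 2].
Proof.
have [d [d0 dlip dpred]] := exists_distance e_sym (e_conn v).
have l1 : #|level d 1| = deg v.
  by apply: eq_card => x; rewrite !inE (nbr_v e_sym e_irr d0 dlip dpred).
exists d; split=> //.
  split=> //; rewrite lt0n; apply/negP => /eqP/cards0_eq no.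
  apply: (not_bipartite (c := fun x => odd (d x))) => x y exy.
  have : (x, y) \notin inlevel e d by rewrite no inE.
  rewrite in_inlevel exy /=.
  by case: (edge_levels e_sym dlip exy) => ->; rewrite ?eqxx //=; case: (odd _).
have := excess e_sym second_common d0 dlip dpred.
rewrite card_edge_pairs // edge_count l1 card_ord; move: #|inlevel e d| => i; lia.
Qed.

Lemma sparse_candle v : deg v = 2 -> exists f : {perm 'I_n}, forall i j : 'I_n,
    e i j = candle_rel (n.-1)./2 (f i) (f j).
Proof.
move=> dv; have [d [d0 dlip dpred [l1 inl] ex]] := distance_levels v.
rewrite dv in l1 ex.
(* With degree 2 the identity leaves exactly one inner edge and no surplus. *)
have inl2 : #|inlevel e d| = 2 by move: inl ex; move: #|_| (\sum_(_ | _) _) => i s; lia.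
have s0 : \sum_(x | 2 <= d x) (#|back e d x| - 2) == 0.
  by move: ex; rewrite inl2; move: (\sum_(_ | _) _) => s; lia.
have b2 x : 2 <= d x -> #|back e d x| = 2.
  move=> dx; move: s0; rewrite sum_nat_eq0 => /forallP/(_ x); rewrite dx /= => /eqP.
  by have := card_back_ge2 e_sym second_common dlip dpred dx; move: #|_| => b; lia.
have odd_card : odd #|'I_n| by rewrite card_ord.
have [m _ m_max] := @arg_maxnP _ v xpredT d isT.
have K0 : 0 < d m.
  have /set0Pn[x] : level d 1 != set0 by rewrite -card_gt0 l1.
  by rewrite in_level => /eqP dx; have := m_max x isT; rewrite /= dx.
have K_max x : d x <= d m by apply: m_max.
have K_ex : exists x, d x = d m by exists m.
have order := candle_order e_sym e_irr second_common d0 dlip dpred parallel odd_card l1 inl2 b2 K_max K_ex.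
rewrite card_ord in order.
have [|k|f fE] := candle_labelling order K_max.
- by rewrite -/(level d 0) (level0 d0) cards1.
- rewrite -/(level d k.+1); have [->|/set0Pn[x]] := eqVneq (level d k.+1) set0.
    by rewrite cards0.
  rewrite in_level => /eqP dx.
  by rewrite (candle_level_card e_sym e_irr second_common d0 dlip dpred parallel odd_card l1 inl2 b2) //; exists x.
have nK : n.-1./2 = d m by move: (d m) order => k ->; rewrite /= doubleK.
exists f => i j; rewrite nK /candle_rel !fE (inj_eq val_inj) (inj_eq perm_inj).
exact: candle_adjacency.
Qed.

Lemma sparse_not_cubic v : (forall x, 3 <= deg x) -> deg v = 3 -> False.
Proof.
move=> deg3 dv; have [d [d0 dlip dpred [l1 inl] ex]] := distance_levels v.
rewrite dv in l1 ex.
have odd_card : odd #|'I_n| by rewrite card_ord.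
have ge2 := card_back_ge2 e_sym second_common dlip dpred.
(* With degree 3 the size of [inlevel] is positive and, with twice the surplus, adds up to 4. *)
have [inl2|inl4] : (#|inlevel e d| = 2 /\ \sum_(x | 2 <= d x) (#|back e d x| - 2) = 1) \/
    (#|inlevel e d| = 4 /\ \sum_(x | 2 <= d x) (#|back e d x| - 2) = 0).
  by move: inl ex; move: #|_| (\sum_(_ | _) _) => i s; lia.
- case: inl2 => inl2 /sum_nat_one[x0 [dx0 bx0 others]].
  have b3 : #|back e d x0| = 3 by lia.
  apply: (@cubic_one_inlevel_edge _ e e_sym e_irr second_common v d d0 dlip dpred
    odd_card l1 deg3 inl2 x0 b3).
  by move=> x nx dx; have := others x dx nx; have := ge2 x dx; move: #|_| => b; lia.
case: inl4 => inl4 /eqP; rewrite sum_nat_eq0 => /forallP s0.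
apply: (@cubic_two_inlevel_edges _ e e_sym e_irr second_common v d d0 dlip dpred
    odd_card l1 deg3 inl4).
by move=> x dx; have := s0 x; have := ge2 x dx; rewrite dx; move: #|_| => b; lia.
Qed.

Lemma sparse_isomorphic_candle : exists f : {perm 'I_n}, forall i j : 'I_n,
    e i j = candle_rel (n.-1)./2 (f i) (f j).
Proof.
(* Since an inner edge exists, the identity excludes degrees 0 and 1. *)
have ge2 v : 2 <= deg v.
  by have [d [_ _ _ [_ inl] ex]] := distance_levels v;
     move: inl ex; move: #|inlevel e d| (\sum_(_ | _) _) (deg v) => i s q; lia.
case: (pickP [pred v | deg v == 2]) => [v /eqP dv|no2]; first exact: sparse_candle dv.
have ge3 x : 3 <= deg x.
  by have := ge2 x; rewrite leq_eqVlt eq_sym; have /= -> := no2 x.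
have [v dv] := exists_small_degree.
by case: (sparse_not_cubic ge3 (v := v)); apply/eqP; rewrite eqn_leq dv ge3.
Qed.

End Sparse.

Theorem mainTheorem11 (n : nat) (e : rel 'I_n) :
  simple_graph e -> graph_connected e -> odd n -> (3 <= n)%N ->
  q_eq e 2 -> num_edges e = (2 * n - 3)%N ->
  exists f : {perm 'I_n}, forall i j : 'I_n,
    e i j = candle_rel (n.-1)./2 (f i) (f j).
Proof.
move=> [e_sym e_irr] e_conn n_odd n_ge3 [[A [[symA A_pat] [s [_ size_s eigA]]]] _] edges.
case: s size_s eigA => [|r [|t []]] // _ eigA.
have [B [symB BA orthB]] := two_eigenvalues_orthogonal_rows symA (fun a => proj1 (eigA a)).
have B_pat i j : i != j -> (B i j != 0%R) = e i j by move=> nij; rewrite BA ?A_pat.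
have nbr x : exists y, e x y.
  have [y nxy] : exists y : 'I_n, y != x.
    have : 1 < #|'I_n| by rewrite card_ord ltnW.
    move=> /card_gt1P[a [b [_ _ nab]]]; have [ax|nax] := eqVneq a x; last by exists a.
    by exists b; rewrite -ax eq_sym.
  have /connectP[[|z p] /= ep yx] := e_conn x y; first by rewrite yx eqxx in nxy.
  by exists z; case/andP: ep.
apply: sparse_isomorphic_candle => //.
- exact: orthogonal_second_common_neighbour e_irr symB B_pat orthB.
- exact: orthogonal_parallel_rows e_irr symB B_pat orthB.
by move=> c; apply: (orthogonal_not_bipartite e_irr symB B_pat orthB).
Qed.
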